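(* For every positive integer $h$ there are $\varepsilon_0=\varepsilon_0(h)>0$ and $\alpha=\alpha(h)>0$ with the following property. For every oriented graph $H$ on $h$ vertices that is not $2$-colorable, for every $0<\varepsilon<\varepsilon_0$, there is $n_0=n_0(\varepsilon)$ such that for every $n\ge n_0$ there is a tournament $T$ on $n$ vertices which is $\varepsilon$-far from being $H$-free but contains at most $\varepsilon^{\alpha\log(1/\varepsilon)}n^h$ copies of $H$.
   Context: An oriented graph is a directed graph without loops with at most one edge between any two distinct vertices. An oriented graph $H$ is $2$-colorable if $V(H)$ can be partitioned into $2$ sets each inducing an acyclic digraph. A tournament $T$ on $n$ vertices is $\varepsilon$-far from being $H$-free if one must reverse the direction of at least $\varepsilon n^2$ edges of $T$ to obtain a tournament containing no copy of $H$; a copy of $H$ in $T$ is a (not necessarily induced) subgraph of $T$ isomorphic to $H$. *)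

(* Defs.v *)
From mathcomp Require Import all_boot.
From Stdlib Require Import Reals.
Set Implicit Arguments. Unset Strict Implicit. Unset Printing Implicit Defensive.

Definition oriented (h : nat) (H : rel 'I_h) : Prop :=
  (forall i, ~~ H i i) /\ (forall i j, H i j -> ~~ H j i).

Definition tournament (n : nat) (T : rel 'I_n) : Prop :=
  (forall i, ~~ T i i) /\ (forall i j, i != j -> (T i j (+) T j i)).

Definition induced (V : finType) (e : rel V) (S : {set V}) : rel V :=
  [rel a b | [&& a \in S, b \in S & e a b]].

Definition acyclic_on (V : finType) (e : rel V) (S : {set V}) : Prop :=
  ~ exists x y, induced e S x y /\ connect (induced e S) y x.

Definition two_colorable (h : nat) (H : rel 'I_h) : Prop :=
  exists C : {set 'I_h}, acyclic_on H C /\ acyclic_on H (~: C).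

Definition embeds (h n : nat) (H : rel 'I_h) (T : rel 'I_n) (f : {ffun 'I_h -> 'I_n}) : bool :=
  injectiveb f && [forall i, forall j, H i j ==> T (f i) (f j)].

(* The copy (subgraph: vertex set, edge set) of H in T given by f. *)
Definition copy_of (h n : nat) (H : rel 'I_h) (f : {ffun 'I_h -> 'I_n})
  : {set 'I_n} * {set 'I_n * 'I_n} :=
  (f @: [set: 'I_h], [set (f p.1, f p.2) | p in [set p : 'I_h * 'I_h | H p.1 p.2]]).

Definition copies (h n : nat) (H : rel 'I_h) (T : rel 'I_n) :=
  [set copy_of H f | f in [set f | embeds H T f]].

Definition Hfree (h n : nat) (H : rel 'I_h) (T : rel 'I_n) : Prop :=
  copies H T = set0.

Definition reversals (n : nat) (T T' : rel 'I_n) : nat :=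
  #|[set p : 'I_n * 'I_n | (p.1 < p.2) && (T p.1 p.2 != T' p.1 p.2)]|.

Open Scope R_scope.

Definition far_from_free (h n : nat) (H : rel 'I_h) (T : rel 'I_n) (eps : R) : Prop :=
  forall T' : rel 'I_n, tournament T' -> Hfree H T' ->
    eps * INR n ^ 2 <= INR (reversals T T').

(* Main.v *)
(* Order the vertices of [H]; the pairs joined by an edge of [H] that goes
   backwards form the back graph of the order, and it is never bipartite, because
   a bipartition of it would 2-colour [H].  Conversely, in a tournament obtained
   from a linear order by reversing the pairs of a graph [F], a copy of [H] carries
   an order on [H] whose back graph maps into [F].  Take for [E] a graph that
   receives a back graph of [H] and is minimal for homomorphisms, and build [F] as
   a Ruzsa-Szemeredi graph over [E]: vertices are pairs (position in [H],
   coordinate), and position [p] of the progression (x, a), with [a] in a Behrend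
   set, has coordinate [x + s p * a].  The progressions give many edge-disjoint
   copies of [H].  By minimality of [E], every copy of [H] lifts a fixed cycle of
   [E] to [F]; as [s] increases along this cycle, the closing condition says that
   an element of the Behrend set is a weighted mean of others, so all are equal
   and the last vertex of the cycle is determined by the first two: copies are
   rare.  Blowing up the vertices of [F] gives tournaments of every large order. *)
Require Import Defs.
From Stdlib Require Import Reals Lra Classical.
From mathcomp Require Import all_boot fingroup perm zify.
Set Implicit Arguments. Unset Strict Implicit. Unset Printing Implicit Defensive.
Open Scope R_scope.

(** * Graphs *)

Section Graphs.
Local Open Scope nat_scope.

(** Induct on the number of edges, deleting one edge uv. If the rest is 2-coloured, then either u
    and v are still connected, and a path between them closes up with uv to a cycle, or flipping the
    colours on the component of u repairs the colouring. The parity of the cycle does not matter. *)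
Lemma two_coloring_or_cycle (V : finType) (E : {set V * V}) :
  (forall x y, (x, y) \in E -> (y, x) \in E) -> (forall x, (x, x) \notin E) ->
  (exists c : V -> bool, forall x y, (x, y) \in E -> c x != c y) \/
  (exists x p, [/\ path [rel a b | (a, b) \in E] x p, uniq (x :: p), 1 < size p
     & (x, last x p) \in E]).
Proof.
have [m] := ubnP #|E|; elim: m E => // m IH E ltEm symE irrE.
have [-> | [[u v] uvE]] := set_0Vmem E.
  by left; exists (fun=> true) => x y; rewrite inE.
pose E' := E :\ (u, v) :\ (v, u).
have uNv : u != v by apply: contraL uvE => /eqP->; apply: irrE.
have sE'E : E' \subset E by rewrite /E' !subDset; apply/subsetP=> z zE; rewrite !inE zE !orbT.
have symE' x y : (x, y) \in E' -> (y, x) \in E'.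
  rewrite !inE !xpair_eqE => /and3P[n1 n2 /symE->].
  by rewrite andbT andbC (andbC (y == v)) (andbC (y == u)) n1 n2.
have irrE' x : (x, x) \notin E' by rewrite !inE (negPf (irrE x)) !andbF.
have ltE'E : #|E'| < #|E|.
  by apply: proper_card; apply/properP; split=> //; exists (u, v); rewrite // !inE eqxx andbF.
have ltE'm : #|E'| < m by lia.
have [c2|[x [p [xp up sp xlp]]]] := IH E' ltE'm symE' irrE'.
- case: c2 => c cP; have [cuv|/negP cuv] := boolP (connect [rel a b | (a, b) \in E'] u v).
    right; case/connectP: cuv => p0 /shortenP[p up uniq_p _] vE.
    exists u, p; split=> //; last by rewrite -vE.
      by apply: sub_path up => a b /=; apply: (subsetP sE'E).
    case: p up vE {uniq_p} => [_ /= vu|a [|b p]] //=; first by rewrite vu eqxx in uNv.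
    by rewrite andbT => + va; rewrite -va !inE eqxx andbF.
  left; case: (eqVneq (c u) (c v)) => cc.
    pose D := connect [rel a b | (a, b) \in E'] u.
    exists (fun x => c x (+) D x) => x y xyE.
    have Euv : (D u = true) * (D v = false).
      by split; [exact: connect0 | apply/negP].
    case: (eqVneq (x, y) (u, v)) => [[-> ->]|n1]; first by rewrite !Euv cc; case: (c v).
    case: (eqVneq (x, y) (v, u)) => [[-> ->]|n2]; first by rewrite !Euv cc; case: (c v).
    have xyE' : (x, y) \in E' by rewrite !inE n1 n2.
    have -> : D x = D y.
      apply/idP/idP => h; apply: connect_trans h (connect1 _) => //=; exact: symE'.
    by move: (cP _ _ xyE'); case: (c x) (c y) (D y) => [] [] [].
  exists c => x y xyE.
  case: (eqVneq (x, y) (u, v)) => [[-> ->]|n1] //.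
  case: (eqVneq (x, y) (v, u)) => [[-> ->]|n2]; first by rewrite eq_sym.
  by apply: cP; rewrite !inE n1 n2.
- right; exists x, p; split=> //; last exact: (subsetP sE'E).
  by apply: sub_path xp => a b /=; apply: (subsetP sE'E).
Qed.

Definition graph_hom (V : finType) (E1 E2 : {set V * V}) (f : V -> V) :=
  forall x y, (x, y) \in E1 -> (f x, f y) \in E2.

Lemma ex_minimal (T : Type) (P : T -> Prop) (m : T -> nat) :
  (exists x, P x) -> exists x, P x /\ forall y, P y -> m x <= m y.
Proof.
case=> x0 Px0; have [k] := ubnP (m x0); elim: k x0 Px0 => // k IH x Px ltk.
case: (classic (exists y, P y /\ m y < m x)) => [[y [Py lty]]|no].
  by apply: (IH y) => //; lia.
exists x; split=> // y Py; rewrite leqNgt; apply/negP => lty; apply: no.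
by exists y.
Qed.

(* A graph of [G] that is minimal for homomorphisms and then for the number of
   edges: every hom [E -> B -> E] with [B] in [G] permutes the edges of [E],
   so a power of it is the identity on edges. *)
Lemma rigid_core (V : finType) (G : {set V * V} -> Prop) :
  (exists E, G E) -> (forall E E' f, G E -> graph_hom E E' f -> G E') ->
  exists E, G E /\ forall B f, G B -> graph_hom B E f ->
    exists t, graph_hom E B t /\ forall x y, (x, y) \in E -> f (t x) = x /\ f (t y) = y.
Proof.
move=> exG upG.
pose homb (E1 E2 : {set V * V}) := [exists f : {ffun V -> V},
  [forall x, forall y, ((x, y) \in E1) ==> ((f x, f y) \in E2)]].
have hombP E1 E2 : reflect (exists f, graph_hom E1 E2 f) (homb E1 E2).
  apply: (iffP existsP) => [[f fP]|[f fP]].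
    by exists f => x y; move/forallP/(_ x)/forallP/(_ y)/implyP: fP; apply.
  exists (finfun f); apply/forallP=> x; apply/forallP=> y; apply/implyP=> xy.
  by rewrite !ffunE; apply: fP.
pose below (E : {set V * V}) := [set E' | homb E' E].
have belowS E1 E2 f : graph_hom E1 E2 f -> below E1 \subset below E2.
  move=> fP; apply/subsetP=> E; rewrite !inE => /hombP[g gP]; apply/hombP.
  by exists (f \o g) => x y /gP; apply: fP.
pose N := #|{: V * V}|.
(* Lexicographic measure: first the number of graphs mapping into [E], then the number of edges,
   which is at most [N]. *)
pose mu (E : {set V * V}) := #|below E| * N.+1 + #|E|.
have [E [GE minE]] := ex_minimal mu exG.
have cardE (E' : {set V * V}) : #|E'| <= N by apply: max_card.
have min1 B f : G B -> graph_hom B E f -> #|below B| = #|below E|.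
  move=> GB fP; apply/eqP; rewrite eqn_leq (subset_leq_card (belowS _ _ _ fP)) /=.
  have := minE _ GB; rewrite /mu; have := cardE B; have := cardE E.
  rewrite -[_ <= #|below B|]ltnS -(ltn_pmul2r (ltn0Sn N)) mulSn. 
  by move: (#|below E| * _) (#|below B| * _); lia.
have min2 B f : G B -> graph_hom B E f -> #|E| <= #|B|.
  by move=> GB fP; have := minE _ GB; rewrite /mu (min1 _ _ GB fP); lia.
exists E; split=> // B f GB fP.
(* [B] has no fewer graphs below it than [E], so [E] itself lies below [B]. *)
have [t0 t0P] : exists t, graph_hom E B t.
  apply/hombP; have/eqP := min1 _ _ GB fP.
  have bS := belowS _ _ _ fP.
  rewrite (subset_leqif_card bS).2 => sub.
  have : E \in below E by rewrite inE; apply/hombP; exists id.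
  by move/(subsetP sub); rewrite inE.
pose psi := f \o t0.
have psiE : graph_hom E E psi by move=> x y xy; apply: fP; apply: t0P.
pose Psi (p : V * V) := (psi p.1, psi p.2).
(* The image of [E] is again in [G] and sits inside [E], so edge-minimality forbids that it loses
   edges. *)
have imE : #|Psi @: E| = #|E|.
  apply/eqP; rewrite eqn_leq leq_imset_card /=.
  apply: (min2 _ id).
    apply: (upG E _ psi GE) => x y xy.
    by apply/imsetP; exists (x, y).
  by move=> x y /imsetP[[a b] abE [-> ->]]; apply: psiE.
have injPsi : {in E &, injective Psi} by apply/imset_injP; rewrite imE.
(* Extending by the identity off [E] gives a permutation of all pairs, which has a finite order
   [k]. *)
pose Q p := if p \in E then Psi p else p.
have QE p : (Q p \in E) = (p \in E).
  rewrite /Q; case: ifP => // pE; case: p pE => x y /=; exact: psiE.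
have injQ : injective Q.
  move=> p q eqQ; have := congr1 (fun z => z \in E) eqQ; rewrite /= !QE => pq.
  move: eqQ; rewrite /Q pq; case: ifP => // qE; apply: injPsi => //.
  by rewrite pq.
pose s := perm injQ; pose k := #[s]%g.
have itQ j p : p \in E -> iter j Q p = (iter j psi p.1, iter j psi p.2) /\ iter j Q p \in E.
  move=> pE; elim: j => [|j [IH1 IH2]] /=; first by case: p pE.
  by rewrite QE IH2 {1}/Q IH2 IH1.
have idE p : p \in E -> iter k Q p = p.
  move=> pE; have := expg_order s; move/(congr1 (fun q : {perm V * V} => q p)).
  rewrite perm1 permX; have /eq_iter -> : s =1 Q by move=> z; rewrite permE.
  by [].
have k1 : k = k.-1.+1 by rewrite prednK // order_gt0.
(* With this choice [f \o t] is [psi] iterated [k] times, the identity on edges. *)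
exists (t0 \o iter k.-1 psi); split=> [x y xy|x y xy] /=.
  by apply: t0P; have [eq1 h] := itQ k.-1 _ xy; rewrite eq1 in h.
have /= [eqi _] := itQ k _ xy; move: (idE _ xy); rewrite eqi k1 /= => -[e1 e2].
by split; [exact: e1|exact: e2].
Qed.
End Graphs.

(** * Behrend sets *)

Section Behrend.
Local Open Scope nat_scope.

Definition digits (b k : nat) (v : nat -> nat) := \sum_(i < k) v i * b ^ i.

Lemma digitsS b k v : digits b k.+1 v = v 0 + b * digits b k (v \o succn).
Proof.
rewrite /digits big_ord_recl /= expn0 muln1; congr (_ + _).
rewrite big_distrr /=; apply: eq_bigr => i _.
by rewrite /bump /= add1n expnS mulnCA.
Qed.

Lemma digits_inj b k v w : (forall i, i < k -> v i < b) -> (forall i, i < k -> w i < b) ->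
  digits b k v = digits b k w -> forall i, i < k -> v i = w i.
Proof.
elim: k v w => // k IH v w vb wb; rewrite !digitsS => e.
have b0 : 0 < b by apply: leq_ltn_trans (vb 0 _).
have e0 : v 0 = w 0.
  have := congr1 (modn^~ b) e; rewrite /= ![_ + b * _]addnC ![b * _]mulnC !modnMDl.
  by rewrite !modn_small ?vb ?wb.
have e1 : digits b k (v \o succn) = digits b k (w \o succn).
  by move: e; rewrite e0 => /addnI /eqP; rewrite eqn_pmul2l // => /eqP.
case=> [|i] // lti; apply: (IH (v \o succn) (w \o succn)) e1 _ lti => j /= ltj; [exact: vb|exact: wb].
Qed.

Lemma digits_lt b k v : (forall i, i < k -> v i < b) -> digits b k v < b ^ k.
Proof.
elim: k v => [|k IH] v vb; first by rewrite /digits big_ord0.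
have h : digits b k (v \o succn) < b ^ k by apply: IH => i lti; apply: vb.
have := vb 0 isT; rewrite digitsS expnS => v0.
apply: leq_trans (_ : b * (digits b k (v \o succn)).+1 <= _); last by rewrite leq_mul2l h orbT.
by rewrite mulnS; lia.
Qed.

(* Points on a common sphere: a nontrivial convex combination lies strictly inside. *)
Lemma sphere_convex (J I : finType) (d : J -> nat) (a : J -> I -> nat) (b : I -> nat) (R : nat) :
  (forall j, 0 < d j) ->
  (forall j, \sum_i a j i ^ 2 = R) -> \sum_i b i ^ 2 = R ->
  (forall i, \sum_j d j * a j i = (\sum_j d j) * b i) ->
  forall j i, a j i = b i.
Proof.
move=> d0 aR bR mean.
have le j i : 2 * (d j * (a j i * b i)) <= d j * (a j i ^ 2 + b i ^ 2) ?= iff (a j i == b i).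
  have [h1 h2] := nat_Cauchy (a j i) (b i); split.
    by rewrite mulnCA leq_mul2l h1 orbT.
  by rewrite mulnCA eqn_pmul2l.
have := leqif_sum (fun (p : J * I) (_ : true) => le p.1 p.2).
case=> _; 
rewrite -(pair_bigA _ (fun j i => 2 * (d j * (a j i * b i)))) /=.
rewrite -(pair_bigA _ (fun j i => d j * (a j i ^ 2 + b i ^ 2))) /=.
have -> : \sum_j \sum_i d j * (a j i ^ 2 + b i ^ 2) = (\sum_j d j) * (2 * R).
  rewrite big_distrl /=; apply: eq_bigr => j _.
  by rewrite -big_distrr /= big_split /= aR bR mul2n addnn.
have -> : \sum_j \sum_i 2 * (d j * (a j i * b i)) = (\sum_j d j) * (2 * R).
  rewrite exchange_big /= mulnCA -bR big_distrr big_distrr /=; apply: eq_bigr => i _.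
  rewrite -big_distrr /=; congr (2 * _).
  rewrite -mulnn mulnA -mean big_distrl /=.
  by apply: eq_bigr => j _; rewrite mulnA.
rewrite eqxx => /esym /forallP h j i.
by apply/eqP; apply: (h (j, i)).
Qed.

(** The index type [J] is arbitrary, so that one set serves cycles of every length. *)
Definition convex_free (M : nat) (S : nat) (A : {set 'I_M}) : Prop :=
  forall (J : finType) (d : J -> nat) (a : J -> 'I_M) (b : 'I_M),
    (forall j, 0 < d j) -> \sum_j d j <= S -> (forall j, a j \in A) -> b \in A ->
    \sum_j d j * a j = (\sum_j d j) * b -> forall j, a j = b.

(** Digit vectors with entries below [2 ^ k] are read in base [S * 2 ^ k]: sums of total weight at
    most [S] do not carry, so an equation between encodings holds digit by digit, and
    [sphere_convex] applies on a single sphere. The most popular of the [k * 4 ^ k + 1] possible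
    spheres is kept, at the cost of a factor [8 ^ k]; the base costs [S ^ k]. *)
Lemma behrend (S k : nat) : 0 < S -> 0 < k ->
  let M := (S * 2 ^ k) ^ k in
  exists A : {set 'I_M}, M <= #|A| * (8 * S) ^ k /\ convex_free S A.
Proof.
move=> S0 k0 M; set q := 2 ^ k; set B := S * q.
have q0 : 0 < q by rewrite expn_gt0.
pose val_ (v : {ffun 'I_k -> 'I_q}) (i : nat) : nat := if insub i is Some j then v j else 0.
have valE v (i : 'I_k) : val_ v i = v i by rewrite /val_ valK.
have val_lt v i : i < k -> val_ v i < q by rewrite /val_ => lti; rewrite insubT /=.
have qB : q <= B by rewrite leq_pmull.
have valB v i : i < k -> val_ v i < B by move=> lti; apply: leq_trans (val_lt v i lti) qB.
pose enc (v : {ffun 'I_k -> 'I_q}) : 'I_M := Ordinal (digits_lt (valB v)).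
have enc_inj : injective enc.
  move=> v w /(congr1 val) /= e; apply/ffunP=> i; apply: val_inj.
  by rewrite /= -!valE; apply: digits_inj e _ _ => // j; apply: valB.
pose normsq (v : {ffun 'I_k -> 'I_q}) := \sum_i (v i : nat) ^ 2.
have norm_lt v : normsq v < (k * q ^ 2).+1.
  rewrite ltnS; apply: leq_trans (_ : \sum_(i < k) q ^ 2 <= _).
    by apply: leq_sum => i _; rewrite leq_exp2r // ltnW.
  by rewrite sum_nat_const card_ord.
pose shell (R : 'I_(k * q ^ 2).+1) := [set v | Ordinal (norm_lt v) == R].
pose R := [arg max_(R > ord0) #|shell R|].
have maxR R' : #|shell R'| <= #|shell R|.
  by rewrite /R; case: arg_maxnP => // i _; apply.
have total : q ^ k <= (k * q ^ 2).+1 * #|shell R|.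
  rewrite -[X in X ^ k]card_ord -[X in _ ^ X]card_ord -card_ffun -[X in X <= _]sum1_card.
  rewrite (partition_big (fun v => Ordinal (norm_lt v)) xpredT) //=.
    have -> : (k * q ^ 2).+1 * #|shell R| = \sum_(R' < (k * q ^ 2).+1) #|shell R|.
    by rewrite sum_nat_const card_ord.
  by apply: leq_sum => R' _; rewrite sum1dep_card; apply: maxR.
have shellP v : v \in shell R -> normsq v = R by rewrite inE => /eqP /(congr1 val).
exists (enc @: shell R); split.
  rewrite card_imset // /M -/q /B expnMn [8 * S]mulnC expnMn mulnCA leq_mul2l; apply/orP; right.
  apply: leq_trans total _; rewrite mulnC leq_mul2l; apply/orP; right.
  have -> : 8 ^ k = q * q ^ 2 by rewrite -expnS -expnM mulnC expnM.
  have kq : k < q by apply: ltn_expl.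
  apply: leq_trans (_ : k.+1 * q ^ 2 <= _).
    by have : 0 < q ^ 2 by [rewrite expn_gt0 q0]; rewrite mulSn; lia.
  by rewrite leq_mul2r kq orbT.
move=> J d a b d0 dS aA bA eqn j.
have /fin_all_exists [va vaP] j0 : exists v, v \in shell R /\ a j0 = enc v.
  by have /imsetP[v ? ?] := aA j0; exists v.
have /imsetP[vb vbR bE] := bA; subst b.
rewrite (vaP j).2; congr enc; apply/ffunP => i; apply: val_inj => /=.
pose c (j : J) (i : 'I_k) := va j i : nat.
apply: (@sphere_convex J _ d c (fun i => vb i) R) => //.
- by move=> j0; rewrite -(shellP _ (vaP j0).1).
- by rewrite -(shellP _ vbR).
move=> i0; rewrite /c.
transitivity (\sum_j0 d j0 * val_ (va j0) i0); first by apply: eq_bigr => j0 _; rewrite valE.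
rewrite -(valE vb).
apply: (@digits_inj B k (fun i => \sum_j0 d j0 * val_ (va j0) i) (fun i => (\sum_j0 d j0) * val_ vb i)) => //.
- move=> i1 lti1; apply: leq_ltn_trans (_ : \sum_j0 d j0 * q.-1 < B).
    by apply: leq_sum => j0 _; rewrite leq_mul2l -ltnS prednK // val_lt ?orbT.
  rewrite -big_distrl /=; apply: leq_ltn_trans (_ : S * q.-1 < B); first by rewrite leq_mul2r dS orbT.
  by rewrite ltn_pmul2l // prednK.
- move=> i1 lti1; apply: leq_ltn_trans (_ : S * q.-1 < B).
    by apply: leq_mul => //; rewrite -ltnS prednK // val_lt.
  by rewrite ltn_pmul2l // prednK.
transitivity (\sum_j0 d j0 * a j0).
  rewrite /digits /=; under eq_bigr => i1 _ do rewrite big_distrl /=.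
  rewrite exchange_big /=; apply: eq_bigr => j0 _.
  rewrite (vaP j0).2 /= /digits big_distrr /=.
  by apply: eq_bigr => i1 _; rewrite mulnA.
by rewrite eqn /= /digits big_distrr /=; apply: eq_bigr => i1 _; rewrite mulnA.
Qed.
End Behrend.

(** * The tournament *)

Section Construction.
Local Open Scope nat_scope.

Definition back (h : nat) (H : rel 'I_h) (o : 'I_h -> nat) : rel 'I_h :=
  [rel i j | H i j && (o j < o i) || H j i && (o i < o j)].

Definition back_graph (h : nat) (H : rel 'I_h) (o : 'I_h -> nat) : {set 'I_h * 'I_h} :=
  [set p | back H o p.1 p.2].

(** The order is existential because each copy of [H] in the tournament brings its own order. *)
Definition receives_back_graph (h : nat) (H : rel 'I_h) (E : {set 'I_h * 'I_h}) : Prop :=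
  exists o phi, injective o /\ graph_hom (back_graph H o) E phi.

Lemma back_sym (h : nat) (H : rel 'I_h) (o : 'I_h -> nat) i j : back H o i j = back H o j i.
Proof. by rewrite /back /= orbC. Qed.

(** An edge of [H] going backwards has ends of different colours, so inside a colour class [o]
    increases along every edge and no directed cycle closes. *)
Lemma two_colorable_back (h : nat) (H : rel 'I_h) (o : 'I_h -> nat) (phi : 'I_h -> 'I_h)
    (E : {set 'I_h * 'I_h}) (c : 'I_h -> bool) :
  oriented H -> injective o -> graph_hom (back_graph H o) E phi ->
  (forall x y, (x, y) \in E -> c x != c y) -> two_colorable H.
Proof.
move=> [irrH _] injo homphi cP.
have up b (C : {set 'I_h}) x y : (forall z, z \in C -> c (phi z) = b) -> induced H C x y -> o x < o y.
  move=> Cb /and3P[xC yC Hxy]; rewrite ltn_neqAle leqNgt.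
  have xNy : x != y by apply: contraTN Hxy => /eqP->; apply: irrH.
  rewrite (inj_eq injo) xNy /=; apply/negP => lt.
  have /homphi/cP : (x, y) \in back_graph H o by rewrite inE /back /= Hxy lt.
  by rewrite !Cb ?eqxx.
have acyc b (C : {set 'I_h}) : (forall z, z \in C -> c (phi z) = b) -> acyclic_on H C.
  move=> Cb [x [y [xy yx]]]; have lt := up b C _ _ Cb xy.
  have : o y <= o x.
    case/connectP: yx => p + ->; elim: p y {xy lt} => [|z p IH] y //= /andP[yz zp].
    exact: leq_trans (ltnW (up b C _ _ Cb yz)) (IH _ zp).
  by rewrite leqNgt lt.
exists [set z | c (phi z)]; split; [apply: (acyc true)|apply: (acyc false)] => z.
  by rewrite inE.
by rewrite !inE => /negbTE.
Qed.

Lemma affine_inj (s s' x x' a a' : nat) : s != s' ->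
  x + s * a = x' + s * a' -> x + s' * a = x' + s' * a' -> x = x' /\ a = a'.
Proof.
move=> ns e1 e2; have ea : a = a'.
  by case: (ltngtP s s') ns => // lt _; nia.
by subst a'; split=> //; lia.
Qed.

(* Consecutive displacements add up to the closing one, a weighted mean with
   the positive weights [sigma j.+1 - sigma j]. *)
Lemma closed_chain (M S : nat) (A : {set 'I_M}) (X sigma : nat -> nat) (l : nat) :
  convex_free S A -> 0 < l ->
  (forall j, j < l -> sigma j < sigma j.+1) -> sigma l <= S ->
  (forall j, j < l -> exists2 a : 'I_M, a \in A & X j + sigma j.+1 * a = X j.+1 + sigma j * a) ->
  (exists2 b : 'I_M, b \in A & X 0 + sigma l * b = X l + sigma 0 * b) ->
  exists b : 'I_M, X 0 + sigma 1 * b = X 1 + sigma 0 * b /\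
                   X 0 + sigma l * b = X l + sigma 0 * b.
Proof.
move=> cf l0 inc lS stepA [b bA close].
have /fin_all_exists [a aP] (j : 'I_l) : exists a : 'I_M,
    a \in A /\ X j + sigma j.+1 * a = X j.+1 + sigma j * a.
  by have [a ? ?] := stepA j (ltn_ord j); exists a.
pose d (j : 'I_l) := sigma j.+1 - sigma j.
have stepE (j : 'I_l) : X j.+1 = X j + d j * a j.
  have le : sigma j * a j <= sigma j.+1 * a j by rewrite leq_mul2r ltnW ?orbT ?inc.
  have := (aP j).2; rewrite /d mulnBl; move: le.
  by move: (sigma j.+1 * a j) (sigma j * a j) (X j) (X j.+1); lia.
have sumE m : m <= l -> X m = X 0 + \sum_(j < l | j < m) d j * a j /\
                        sigma m = sigma 0 + \sum_(j < l | j < m) d j.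
  elim: m => [|m IH] ltm; first by rewrite !big_pred0 ?addn0.
  have [IH1 IH2] := IH (ltnW ltm).
  rewrite (bigD1 (Ordinal ltm)) //= [in X in _ /\ X](bigD1 (Ordinal ltm)) //=.
  have eqp (j : 'I_l) : (j < m.+1) && (j != Ordinal ltm) = (j < m).
    by rewrite -val_eqE /= ltnS ltn_neqAle andbC.
  rewrite !(eq_bigl _ _ eqp) (stepE (Ordinal ltm)) /= IH1; split; first by rewrite -addnA [in RHS](addnC (d _ * _)).
  by rewrite addnCA -IH2 /d /= subnK // ltnW ?inc.
have [Xl sl] := sumE l (leqnn l).
have allp (j : 'I_l) : (j < l) = true by rewrite ltn_ord.
rewrite !(eq_bigl _ _ allp) in Xl sl.
have ab : forall j, a j = b.
  apply: (cf _ d) => //.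
  - by move=> j; rewrite subn_gt0 inc.
  - by apply: leq_trans lS; rewrite sl leq_addl.
  - by move=> j; case: (aP j).
  move: close; rewrite Xl sl mulnDl -addnA => /addnI.
  by rewrite addnC => /addIn.
exists b; split=> //.
by have := (aP (Ordinal l0)).2; rewrite ab.
Qed.

(** A map in [D] is recovered from its values off [e] and the code of its value at [e]; this
    replaces one factor [n] by [#|C|]. *)
Lemma card_determined (h n : nat) (C : finType) (e : 'I_h.+1) (code : 'I_n -> C)
    (D : {set {ffun 'I_h.+1 -> 'I_n}}) :
  (forall f g, f \in D -> g \in D -> (forall i, i != e -> f i = g i) ->
     code (f e) = code (g e) -> f e = g e) ->
  #|D| <= n ^ h * #|C|.
Proof.
move=> Ddet.
pose r (f : {ffun 'I_h.+1 -> 'I_n}) := ([ffun i : 'I_h => f (lift e i)], code (f e)).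
have injr : {in D &, injective r}.
  move=> f g fD gD [/ffunP efg ecode].
  have off i : i != e -> f i = g i.
    rewrite eq_sym => /unlift_some[j -> _].
    by have := efg j; rewrite !ffunE.
  apply/ffunP => i; case: (eqVneq i e) => [->|]; last exact: off.
  exact: Ddet.
rewrite -(card_in_imset injr); apply: leq_trans (max_card _) _.
by rewrite card_prod card_ffun !card_ord.
Qed.

End Construction.

(** * The linear order twisted along the blown-up Ruzsa-Szemeredi graph *)

Section Tournament.
Local Open Scope nat_scope.
Variables (h n M N : nat) (H : rel 'I_h.+1) (A : {set 'I_M}) (s o : 'I_h.+1 -> nat).
Hypotheses (oriH : oriented H) (inj_o : injective o) (inj_s : injective s) (N0 : 0 < N).

(* A vertex is encoded as [(t * N + x) * h.+1 + p]: position [p], coordinate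
   [x < N], and index [t] inside the blown-up class [(p, x)]. *)
Definition pos (v : nat) : 'I_h.+1 := inord (v %% h.+1).
Definition coord (v : nat) := v %/ h.+1 %% N.
Definition block (v : nat) := v %/ h.+1 %/ N.

(** The difference of coordinates is the difference of the values of [s] times an element of [A],
    written without subtraction. Ignoring [block] makes this graph a blow-up. *)
Definition special (u v : nat) : bool :=
  back H o (pos u) (pos v) &&
  [exists a : 'I_M, (a \in A) &&
    (coord u + s (pos v) * a == coord v + s (pos u) * a)].

(** Since [v < n], this is the lexicographic order: first the rank of the position, then [v]. *)
Definition key (v : 'I_n) := o (pos v) * n + v.

Definition twisted : rel 'I_n :=
  [rel u v | (u != v) && ((key u < key v) (+) special u v)].

Lemma special_sym u v : special u v = special v u.
Proof.
by rewrite /special back_sym; congr (_ && _); apply: eq_existsb => a; rewrite eq_sym.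
Qed.

Lemma key_lt (u v : 'I_n) : pos u != pos v -> (key u < key v) = (o (pos u) < o (pos v)).
Proof.
move=> npos; have un := ltn_ord u; have vn := ltn_ord v; rewrite /key.
case: (ltngtP (o (pos u)) (o (pos v))) => [lt|lt|/inj_o e]; last by rewrite e eqxx in npos.
  by apply/idP; nia.
by apply/negbTE; rewrite -leqNgt; nia.
Qed.

Lemma key_inj : injective key.
Proof.
move=> u v e; apply: val_inj; rewrite /=.
case: (eqVneq (pos u) (pos v)) => [ep|np]; first by move: e; rewrite /key ep => /addnI.
have := key_lt np; have := @key_lt v u; rewrite eq_sym => /(_ np).
rewrite e ltnn => /esym /negbT; rewrite -leqNgt => le1 /esym /negbT.
rewrite -leqNgt => le2; have : o (pos u) = o (pos v) by apply/eqP; rewrite eqn_leq le1 le2.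
by move/inj_o => ep; rewrite ep eqxx in np.
Qed.

Lemma twisted_tournament : tournament twisted.
Proof.
split=> [i|i j nij]; first by rewrite /twisted /= eqxx.
rewrite /twisted /= [j == i]eq_sym nij /= special_sym.
have : key i != key j by apply: contraNneq nij => /key_inj->.
by case: (ltngtP (key i) (key j)) => //; case: special.
Qed.

Lemma back_irrefl i : back H o i i = false.
Proof. by rewrite /back /= ltnn andbF. Qed.

(** A forward edge of [H] joins a pair that is never special and keeps the linear order; a back edge
    is special and gets reversed. *)
Lemma twistedE (u v : 'I_n) : H (pos u) (pos v) ->
  (back H o (pos u) (pos v) -> special u v) -> twisted u v.
Proof.
move=> Huv sp; have [irrH asymH] := oriH.
have np : pos u != pos v by apply: contraTneq Huv => ->; apply: irrH.
rewrite /twisted /= (contraNneq _ np) => [|->] //=; rewrite key_lt //.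
move: sp; rewrite /special /back /= Huv (negPf (asymH _ _ Huv)) orbF /=.
case: (ltngtP (o (pos u)) (o (pos v))) => [||/inj_o e] //= ; last by rewrite e eqxx in np.
by move=> _ ->.
Qed.

Definition vertex (t x p : nat) := (t * N + x) * h.+1 + p.

Lemma vertex_coords t x (p : 'I_h.+1) : x < N ->
  [/\ pos (vertex t x p) = p, coord (vertex t x p) = x & block (vertex t x p) = t].
Proof.
move=> xN; rewrite /pos /coord /block /vertex modnMDl divnMDl // modn_small // inord_val.
by rewrite divn_small // addn0 modnMDl divnMDl // modn_small // divn_small // addn0.
Qed.

Lemma coords_inj u v : pos u = pos v -> coord u = coord v -> block u = block v -> u = v.
Proof.
move=> /(congr1 val); rewrite /= !inordK ?ltn_mod // => e1 e2 e3.
rewrite (divn_eq u h.+1) (divn_eq v h.+1) e1; congr (_ * _ + _).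
by rewrite (divn_eq (u %/ h.+1) N) (divn_eq (v %/ h.+1) N) -/(coord u) -/(coord v)
  -/(block u) -/(block v) e2 e3.
Qed.

Lemma vertex_lt r t x p : t < r -> x < N -> p < h.+1 -> r * N * h.+1 <= n -> vertex t x p < n.
Proof.
move=> tr xN ph; apply: leq_trans; rewrite /vertex.
have h1 : t * N + x < r * N by nia.
by nia.
Qed.

(** * Many edge-disjoint copies of [H] *)

Section Far.
Variables (S rho : nat).
Hypotheses (NE : N = M * S.+1) (sS : forall p, s p <= S) (fit : S.+1 * rho * N * h.+1 <= n).

(** A model copy is indexed by two progressions, one for the coordinates and one for the blocks; the
    second keeps copies edge-disjoint in the blow-up. *)
Let idx := ('I_M * 'I_M * ('I_rho * 'I_rho))%type.

Let cx (c : idx) (p : 'I_h.+1) := c.1.1 + s p * c.1.2.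
Let ct (c : idx) (p : 'I_h.+1) := c.2.1 + s p * c.2.2.

Lemma affine_lt m (x a : 'I_m) p : x + s p * a < m * S.+1.
Proof.
have := ltn_ord x; have := ltn_ord a; have := sS p; move: (s p) (x : nat) (a : nat).
by move=> sp x0 a0; nia.
Qed.

Lemma cxN c p : cx c p < N. Proof. by rewrite NE affine_lt. Qed.

Lemma model_vertex_lt c (p : 'I_h.+1) : vertex (ct c p) (cx c p) p < n.
Proof.
apply: (@vertex_lt (S.+1 * rho)) => //; last exact: cxN.
by rewrite mulnC affine_lt.
Qed.

Let model (c : idx) (p : 'I_h.+1) : 'I_n := Ordinal (model_vertex_lt c p).

Lemma model_inj c : injective (model c).
Proof.
move=> p q /(congr1 val) /= e.
by have [<- _ _] := vertex_coords (ct c p) p (cxN c p);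
   rewrite e; have [-> _ _] := vertex_coords (ct c q) q (cxN c q).
Qed.

Lemma model_copy c p q : c.1.2 \in A -> H p q -> twisted (model c p) (model c q).
Proof.
move=> cA Hpq.
have [ep xp _] := vertex_coords (ct c p) p (cxN c p).
have [eq_ xq _] := vertex_coords (ct c q) q (cxN c q).
apply: twistedE; rewrite /= ep eq_ // => bk.
rewrite /special ep eq_ bk /=; apply/existsP; exists c.1.2.
by rewrite cA xp xq /cx addnAC eqxx.
Qed.

(** [s] takes distinct values at [p] and [q], so two vertices fix both affine progressions. *)
Lemma model_disjoint c c' p q : p != q ->
  model c p = model c' p -> model c q = model c' q -> c = c'.
Proof.
move=> npq /(congr1 val) /= e1 /(congr1 val) /= e2.
have ns : s p != s q by rewrite (inj_eq inj_s).
have [_ xp tp] := vertex_coords (ct c p) p (cxN c p).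
have [_ xp' tp'] := vertex_coords (ct c' p) p (cxN c' p).
have [_ xq tq] := vertex_coords (ct c q) q (cxN c q).
have [_ xq' tq'] := vertex_coords (ct c' q) q (cxN c' q).
rewrite e1 in xp tp; rewrite e2 in xq tq.
have [||a b] := @affine_inj (s p) (s q) c.1.1 c'.1.1 c.1.2 c'.1.2 ns.
- by move: xp'; rewrite xp.
- by move: xq'; rewrite xq.
have [||a' b'] := @affine_inj (s p) (s q) c.2.1 c'.2.1 c.2.2 c'.2.2 ns.
- by move: tp'; rewrite tp.
- by move: tq'; rewrite tq.
move: c c' a b a' b' {e1 e2 xp xp' tp tp' xq xq' tq tq'} => [[x y] [z t]] [[x' y'] [z' t']] /=.
by move=> /val_inj-> /val_inj-> /val_inj-> /val_inj->.
Qed.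

(** Each model copy with difference in [A] must lose an edge in [T'], and edge-disjointness makes
    the lost edges distinct. *)
Lemma twisted_far (T' : rel 'I_n) : tournament T' -> Hfree H T' ->
  M * #|A| * rho ^ 2 <= reversals twisted T'.
Proof.
move=> [irrT' totT'] freeT'.
pose D : {set idx} := setX (setX [set: 'I_M] A) [set: 'I_rho * 'I_rho].
have cardD : #|D| = M * #|A| * rho ^ 2.
  by rewrite !cardsX !cardsT card_prod !card_ord -mulnn.
have broken c : c \in D -> exists pq : 'I_h.+1 * 'I_h.+1,
    H pq.1 pq.2 && ~~ T' (model c pq.1) (model c pq.2).
  move=> cD; apply/existsP; apply: contraT; rewrite negb_exists => /forallP all_ok.
  have : copy_of H [ffun p => model c p] \in copies H T'.
    apply: imset_f; rewrite inE; apply/andP; split.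
      by apply/injectiveP => p q; rewrite !ffunE => /model_inj.
    apply/forallP=> p; apply/forallP=> q; apply/implyP=> Hpq; rewrite !ffunE.
    by move: (all_ok (p, q)); rewrite /= Hpq negbK.
  by rewrite freeT' inE.
(* The default pair is never reached on [D], by [broken]. *)
pose w (c : idx) : 'I_h.+1 * 'I_h.+1 := odflt (ord0, ord0) [pick pq : 'I_h.+1 * 'I_h.+1 |
    H pq.1 pq.2 && ~~ T' (model c pq.1) (model c pq.2)].
have wP c : c \in D -> H (w c).1 (w c).2 && ~~ T' (model c (w c).1) (model c (w c).2).
  move/broken => [pq pqP]; rewrite /w; case: pickP => [//|/(_ pq)]; by rewrite pqP.
(* Pairs are sorted because [reversals] counts each unordered pair once, with the smaller vertex
   first. *)
pose g (c : idx) := let u := model c (w c).1 in let v := model c (w c).2 in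
  if u < v then (u, v) else (v, u).
have wN c : c \in D -> (w c).1 != (w c).2.
  move=> /wP /andP[Hw _]; apply: contraTneq Hw => ->; exact: oriH.1.
have injg : {in D &, injective g}.
  move=> c c' cD c'D; rewrite /g.
  have posm d p : pos (model d p) = p by have [] := vertex_coords (ct d p) p (cxN d p).
  have nw := wN _ cD.
  (* Sorting may match the two edges crosswise; the positions of the shared vertices settle both
     cases. *)
  have fin : (model c (w c).1 = model c' (w c').1 /\ model c (w c).2 = model c' (w c').2) \/
     (model c (w c).1 = model c' (w c').2 /\ model c (w c).2 = model c' (w c').1) -> c = c'.
    case=> -[e1 e2]; have p1 := congr1 (fun v : 'I_n => pos v) e1;
      have p2 := congr1 (fun v : 'I_n => pos v) e2; rewrite /= !posm in p1 p2;
      by apply: (model_disjoint nw); rewrite ?e1 ?e2 ?p1 ?p2.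
  by case: ifP => _; case: ifP => _ e; move: (congr1 fst e) (congr1 snd e) => e1 e2;
    apply: fin; auto.
rewrite -cardD -(card_in_imset injg); apply: subset_leq_card.
apply/subsetP=> _ /imsetP[c cD ->]; rewrite inE.
have /andP[Hw nT'] := wP c cD; have nw := wN c cD.
have Tw : twisted (model c (w c).1) (model c (w c).2).
  by apply: model_copy => //; move: cD; rewrite !inE andbT.
have nuv : model c (w c).1 != model c (w c).2 by rewrite (inj_eq (@model_inj c)).
rewrite /g; case: ifP => lt; rewrite /= ?lt /=; first by rewrite Tw (negPf nT').
have [_ totT] := twisted_tournament.
rewrite ltn_neqAle leqNgt lt [_ == _ :> nat]eq_sym nuv /=.
have := totT _ _ nuv; have := totT' _ _ nuv; rewrite Tw (negPf nT') /=.
by move=> ->; case: twisted.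
Qed.
End Far.

(** * Rarity of copies of [H] *)

Section Few.
Variables (S : nat) (E : {set 'I_h.+1 * 'I_h.+1}) (phi : 'I_h.+1 -> 'I_h.+1).
Variables (x0 : 'I_h.+1) (p0 : seq 'I_h.+1).
Hypotheses (phiE : graph_hom (back_graph H o) E phi) (sS : forall p, s p <= S)
  (cfA : convex_free S A).
Hypothesis rigE : forall B f, receives_back_graph H B -> graph_hom B E f ->
  exists t, graph_hom E B t /\ forall x y, (x, y) \in E -> f (t x) = x /\ f (t y) = y.
Hypotheses (pathE : path [rel a b | (a, b) \in E] x0 p0)
  (uniq_p : uniq (x0 :: p0)) (p0gt1 : 1 < size p0) (closeE : (x0, last x0 p0) \in E).
Hypothesis s_mono : forall p q,
  index (phi p) (x0 :: p0) < index (phi q) (x0 :: p0) -> s p < s q.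

(** Order [H] by the keys of the images. An edge of [H] that goes backwards there is an edge of the
    tournament against the linear order, which only special pairs have. *)
Lemma copy_special f : embeds H twisted f ->
  forall i j, back H (key \o f) i j -> special (f i) (f j).
Proof.
case/andP=> _ /forallP emb.
have dir i j : H i j -> key (f j) < key (f i) -> special (f i) (f j).
  move=> Hij lt; move/forallP/(_ j)/implyP/(_ Hij): (emb i).
  by rewrite /twisted /= ltnNge (ltnW lt) => /andP[].
move=> i j /orP[/andP[]|/andP[Hji lt]]; first exact: dir.
by rewrite special_sym; apply: dir.
Qed.

(** Special pairs sit on back pairs of positions, so [phi] after [pos] maps the back graph of the
    copy into [E]; rigidity provides a section of this map on edges. *)
Lemma copy_lift f : embeds H twisted f -> exists t, forall x y, (x, y) \in E ->
  [/\ special (f (t x)) (f (t y)), phi (pos (f (t x))) = x & phi (pos (f (t y))) = y].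
Proof.
move=> emb; have sp := copy_special emb; have /andP[/injectiveP injf _] := emb.
have [||t [tE tP]] := @rigE (back_graph H (key \o f)) (fun i => phi (pos (f i))).
- by exists (key \o f), id; split=> [|//]; apply: inj_comp injf; apply: key_inj.
- move=> i j; rewrite inE /= => /sp /andP[bk _].
  by apply: phiE; rewrite inE.
exists t => x y xy; have [ex ey] := tP _ _ xy; split=> //.
by apply: sp; have := tE _ _ xy; rewrite inE.
Qed.

(** The images of [e1] and [e2] fix [b], and [b] fixes the coordinate of the image of [e3] once its
    position is known. *)
Definition determined (e1 e2 e3 : 'I_h.+1) (f : {ffun 'I_h.+1 -> 'I_n}) : bool :=
  [&& e1 != e3, e2 != e3, s (pos (f e1)) < s (pos (f e2)) &
    [exists b : 'I_M,
      (coord (f e1) + s (pos (f e2)) * b == coord (f e2) + s (pos (f e1)) * b) &&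
      (coord (f e1) + s (pos (f e3)) * b == coord (f e3) + s (pos (f e1)) * b)]].

Lemma copy_determined f : embeds H twisted f -> exists e1 e2 e3, determined e1 e2 e3 f.
Proof.
move=> emb; have [t tP] := copy_lift emb.
pose c j := nth x0 (x0 :: p0) j; pose l := size p0.
have edge j : j < l -> (c j, c j.+1) \in E.
  by move=> ltj; have /(pathP x0)/(_ j ltj) := pathE.
have close : (c 0, c l) \in E by rewrite /c /l nth_last.
have ic j : j <= l -> index (c j) (x0 :: p0) = j by move=> ?; rewrite index_uniq.
have pc j : j <= l -> phi (pos (f (t (c j)))) = c j.
  rewrite leq_eqVlt => /orP[/eqP->|/edge/tP[] //].
  by have [] := tP _ _ close.
(* The section separates the vertices of the cycle, because [phi] after [pos] recovers them. *)
have tN i j : i <= l -> j <= l -> i != j -> t (c i) != t (c j).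
  move=> il jl; apply: contraNneq => e; apply/eqP.
  by rewrite -(ic i il) -(ic j jl) -(pc i il) -(pc j jl) e.
pose X j := coord (f (t (c j))); pose sg j := s (pos (f (t (c j)))).
have sgS j : j < l -> sg j < sg j.+1.
  by move=> jl; apply: s_mono; rewrite !pc ?ic // ltnW.
have l0 : 0 < l by apply: ltnW.
have stepE u v : special u v -> exists2 a : 'I_M, a \in A &
    coord u + s (pos v) * a = coord v + s (pos u) * a.
  by case/andP=> _ /existsP[a /andP[aA /eqP e]]; exists a.
have [b [b1 b2]] : exists b : 'I_M, X 0 + sg 1 * b = X 1 + sg 0 * b /\
                   X 0 + sg l * b = X l + sg 0 * b.
  apply: (closed_chain cfA) => //; first exact: sS.
    by move=> j /edge/tP[+ _ _] => /stepE.
  by have [/stepE + _ _] := tP _ _ close.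
(* The first, second and last vertices of the lifted cycle; the last two differ because
   [1 < size p0]. *)
exists (t (c 0)), (t (c 1)), (t (c l)); apply/and4P; split.
- by apply: tN => //; rewrite neq_ltn l0.
- by apply: tN => //; rewrite neq_ltn p0gt1.
- exact: sgS.
by apply/existsP; exists b; apply/andP; split; apply/eqP.
Qed.

Lemma card_determined_maps e1 e2 e3 :
  #|[set f | determined e1 e2 e3 f]| <= n ^ h * (h.+1 * (n %/ (h.+1 * N)).+1).
Proof.
(* The code omits the coordinate, which the other vertices determine; this saves a factor of order
   [N]. *)
pose code (v : 'I_n) : 'I_h.+1 * 'I_(n %/ (h.+1 * N)).+1 := (pos v, inord (block v)).
have -> : h.+1 * (n %/ (h.+1 * N)).+1 = #|{: 'I_h.+1 * 'I_(n %/ (h.+1 * N)).+1}|.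
  by rewrite card_prod !card_ord.
apply: (@card_determined _ _ _ e3 code) => f g.
rewrite !inE => /and4P[n1 n2 lt /existsP[b /andP[/eqP b1 /eqP b2]]].
move=> /and4P[_ _ _ /existsP[b' /andP[/eqP b1' /eqP b2']]] off [epos eblk].
rewrite -(off e1 n1) -(off e2 n2) -epos in b1' b2'.
have ebb : b = b' :> nat.
  move: lt b1 b1' => {b2 b2'}; move: (s _) (s _) (coord _) (coord _) => s1 s2 X1 X2.
  move: (b : nat) (b' : nat) => m m' lt b1 b1'.
  have le k : s2 * k <= s1 * k by rewrite leq_mul2r (ltnW lt) orbT.
  apply/eqP; rewrite -(eqn_pmul2l (_ : 0 < s1 - s2)) ?subn_gt0 // !mulnBl; apply/eqP.
  move: (le m) (le m') b1 b1' => {le}.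
  by move: (s1 * m) (s2 * m) (s1 * m') (s2 * m') => *; lia.
apply: val_inj; apply: coords_inj => //; first by move: b2'; rewrite -ebb b2 => /addIn.
have blt (v : 'I_n) : block v < (n %/ (h.+1 * N)).+1.
  by rewrite ltnS /block -divnMA leq_div2r // ltnW.
by have := congr1 val eblk; rewrite /= !inordK.
Qed.

Lemma twisted_few :
  #|copies H twisted| <= h.+1 ^ 3 * (n ^ h * (h.+1 * (n %/ (h.+1 * N)).+1)).
Proof.
apply: leq_trans (leq_imset_card _ _) _.
pose I3 := ('I_h.+1 * 'I_h.+1 * 'I_h.+1)%type.
apply: leq_trans (_ : #|\bigcup_(e : I3) [set f | determined e.1.1 e.1.2 e.2 f]| <= _).
  apply: subset_leq_card; apply/subsetP=> f; rewrite inE => /copy_determined[e1 [e2 [e3 d]]].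
  by apply/bigcupP; exists (e1, e2, e3); rewrite ?inE.
have cardI : #|{: I3}| = h.+1 ^ 3 by rewrite !card_prod !card_ord !expnS muln1 mulnA.
rewrite -cardI -sum_nat_const.
apply: (@leq_trans (\sum_(e : I3) #|[set f | determined e.1.1 e.1.2 e.2 f]|)); last first.
  by apply: leq_sum => e _; apply: card_determined_maps.
elim/big_ind2: _ => [|m1 D1 m2 D2 h1 h2|e _] //; first by rewrite cards0.
by apply: leq_trans (leq_card_setU _ _) _; apply: leq_add.
Qed.
End Few.
End Tournament.

(** * Assembling the Behrend set, the core and the cycle *)

Section Counting.
Local Open Scope nat_scope.

(* [4 * h.+1 ^ 3] bounds the shifts [s p] and absorbs the factor [2 * h.+1 ^ 3]
   of the count of copies. *)
Lemma sparse_far_tournaments (h k : nat) (H : rel 'I_h.+1) :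
  oriented H -> ~ two_colorable H -> 0 < k ->
  let S := 4 * h.+1 ^ 3 in let M := (S * 2 ^ k) ^ k in let N := M * S.+1 in
  exists m : nat, M <= m * (8 * S) ^ k /\
    forall n rho, S.+1 * rho * N * h.+1 <= n ->
    exists T : rel 'I_n, tournament T /\
      (forall T', tournament T' -> Hfree H T' -> M * m * rho ^ 2 <= reversals T T') /\
      #|copies H T| <= h.+1 ^ 3 * (n ^ h * (h.+1 * (n %/ (h.+1 * N)).+1)).
Proof.
move=> oriH not2 k0 S M N.
have S0 : 0 < S by rewrite muln_gt0 expn_gt0.
have N0 : 0 < N by rewrite muln_gt0 !expn_gt0 muln_gt0 S0 expn_gt0.
have [A [cardA cfA]] := behrend S0 k0.
have [E [[o [phi [injo phiE]]] rigE]] : exists E, receives_back_graph H E /\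
    forall B f, receives_back_graph H B -> graph_hom B E f ->
    exists t, graph_hom E B t /\ forall x y, (x, y) \in E -> f (t x) = x /\ f (t y) = y.
  apply: rigid_core.
    by exists (back_graph H val), (@nat_of_ord _), id; split=> [|x y //]; exact: val_inj.
  move=> E E' f [o [phi [injo phiE]]] fE; exists o, (f \o phi); split=> // x y xy.
  exact: fE (phiE _ _ xy).
have [t [tE tP]] : exists t, graph_hom E (back_graph H o) t /\
    forall x y, (x, y) \in E -> phi (t x) = x /\ phi (t y) = y.
  by apply: rigE => //; exists o, id; split=> // x y.
(* [t] and [phi] carry the symmetry of the back graph over to [E]; [t] alone gives the absence of
   loops. *)
have symE x y : (x, y) \in E -> (y, x) \in E.
  move=> xy; have [ex ey] := tP _ _ xy; rewrite -ex -ey; apply: phiE.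
  by have := tE _ _ xy; rewrite !inE /= back_sym.
have irrE x : (x, x) \notin E.
  by apply/negP=> /tE; rewrite inE /= back_irrefl.
have [[c cP]|[x0 [p0 [pathE uniq_p p0gt1 closeE]]]] := two_coloring_or_cycle symE irrE.
  by case: not2; apply: two_colorable_back phiE cP.
rewrite /= in closeE.
(* The leading term makes [s] increase along the cycle; the remainder [p] makes it injective. *)
pose s (p : 'I_h.+1) := h.+1 * index (phi p) (x0 :: p0) + p.
have inj_s : injective s.
  move=> p q /(congr1 (modn^~ h.+1)).
  by rewrite /s /= ![h.+1 * _]mulnC !modnMDl !modn_small // => /val_inj.
have sS p : s p <= S.
  have le1 : index (phi p) (x0 :: p0) <= h.+1.
    apply: leq_trans (index_size _ _) _; rewrite -(card_uniqP uniq_p).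
    by rewrite -[X in _ <= X]card_ord max_card.
  have le2 := ltn_ord p; rewrite /s /S.
  move: (index _ _) le1 (p : nat) le2 => i le1 j le2.
  have b1 : h.+1 * i + j <= h.+1 * h.+1 + h.+1 by apply: leq_add; [rewrite leq_mul2l le1|exact: ltnW].
  apply: leq_trans b1 _; rewrite !expnS muln1.
  move: (h.+1) (ltn0Sn h) => g g0; nia.
have s_mono p q : index (phi p) (x0 :: p0) < index (phi q) (x0 :: p0) -> s p < s q.
  move=> lt; rewrite /s; apply: leq_trans (_ : h.+1 * (index (phi p) (x0 :: p0)).+1 <= _).
    by rewrite mulnS addnC ltn_add2r.
  by apply: leq_trans (leq_addr _ _); rewrite leq_mul2l lt orbT.
exists #|A|; split=> // n rho fit.
exists (twisted N H A s o); split; first exact: twisted_tournament.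
split=> [T' tourT' freeT'|].
  exact: (@twisted_far h n M N H A s o oriH injo inj_s N0 S rho).
exact: (twisted_few n injo N0 phiE sS cfA rigE pathE uniq_p p0gt1 closeE s_mono).
Qed.

End Counting.

(** * Choice of parameters *)

Lemma INR_expn (m k : nat) : INR (m ^ k)%N = INR m ^ k.
Proof. by elim: k => [|k IH]; rewrite ?expn0 // expnS mult_INR IH. Qed.

Lemma INR_leq (m k : nat) : (m <= k)%N -> INR m <= INR k.
Proof. by move/leP; apply: le_INR. Qed.

Lemma power_bracket (b y : R) : 1 < b -> b < y ->
  exists k : nat, (0 < k)%N /\ b ^ k <= y < b ^ k.+1.
Proof.
move=> b1 by_.
have [|m [ym minm]] := @ex_minimal _ (fun m => y < b ^ m) id.
  have [m mP] := Pow_x_infinity b (ltac:(rewrite Rabs_pos_eq; lra)) (y + 1).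
  exists m; have := mP m (le_n m); rewrite Rabs_pos_eq; first lra.
  by apply: pow_le; lra.
case: m ym minm => [|[|k]] ym minm; [move: ym => /=; lra | move: ym => /=; lra |].
exists k.+1; split=> //; split=> //; case: (Rle_lt_dec (b ^ k.+1) y) => // lt.
by have := minm _ lt; rewrite ltnn.
Qed.

Lemma leq_double_floor (n d : nat) : (0 < d -> d <= n -> n <= 2 * (n %/ d * d))%N.
Proof.
move=> d0 dn; have q0 : (0 < n %/ d)%N by rewrite divn_gt0.
have := ltn_ceil n d0; rewrite mulSn; move: (n %/ d)%N q0 => q q0 lt.
apply: leq_trans (ltnW lt) _; rewrite mul2n -addnn leq_add2r; exact: leq_pmull.
Qed.

(** In the application [g] is [h.+1], [s] is [S.+1], [b] is [(8 * S) ^ k] and [r] is [rho]. Squaring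
    the bound on [n] produces [M ^ 2], one factor of which is traded for [m * b]. *)
Lemma reversal_arith (g s M m b n r : nat) :
  (0 < M -> M <= m * b -> n <= 2 * (r * (g * (M * s) * s)) ->
   n ^ 2 <= M * m * r ^ 2 * (b * (4 * g ^ 2 * s ^ 4)))%N.
Proof.
move=> M0 Mm nr; rewrite -(leq_pmul2l (_ : 0 < M ^ 2)%N) ?expn_gt0 ?M0 //.
apply: leq_trans (_ : M * (m * b) * (2 * (r * (g * (M * s) * s))) ^ 2 <= _)%N.
  by apply: leq_mul; [rewrite expnS expn1 leq_mul2l Mm orbT|rewrite leq_exp2r].
by apply: eq_leq; rewrite !expnS !expn0 !muln1; lia.
Qed.

Theorem theorem4p1 :
  forall h : nat, (0 < h)%N ->
  exists eps0 alpha : R, 0 < eps0 /\ 0 < alpha /\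
    forall H : rel 'I_h, oriented H -> ~ two_colorable H ->
    forall eps : R, 0 < eps -> eps < eps0 ->
    exists n0 : nat, forall n : nat, (n0 <= n)%N ->
      exists T : rel 'I_n, tournament T /\ far_from_free H T eps /\
        INR #|copies H T| <= Rpower eps (alpha * ln (1 / eps)) * INR n ^ h.
Proof.
case=> // h _; pose S := (4 * h.+1 ^ 3)%N; pose C := (4 * h.+1 ^ 2 * S.+1 ^ 4)%N.
pose b := INR (8 * S); pose C1 := INR C.
have S0 : (0 < S)%N by rewrite muln_gt0 expn_gt0.
have b1 : 1 < b by apply: (lt_INR 1); lia.
have C1_ge1 : 1 <= C1 by apply: (@INR_leq 1); rewrite /C 2!muln_gt0 !expn_gt0.
have lnb : 0 < ln b by rewrite -ln_1; apply: ln_increasing; lra.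
have lnC : 0 <= ln C1.
  by case: C1_ge1 => [lt|<-]; [rewrite -ln_1; left; apply: ln_increasing; lra|rewrite ln_1; lra].
have ln2 : 0 < ln 2 by rewrite -ln_1; apply: ln_increasing; lra.
(* Chosen so that [(k + 1) * ln b + ln C1 <= k * C3] whenever [k] is at least 1. *)
pose C3 := ln C1 + 2 * ln b.
have C3_gt0 : 0 < C3 by rewrite /C3; lra.
(* The bound on [eps] guarantees an exponent [k] of at least 1; [alpha] turns [L <= k * C3] into
   [alpha * L ^ 2 <= k ^ 2 * ln 2]. *)
exists (/ (b * C1)), (ln 2 / C3 ^ 2); split; first by apply: Rinv_0_lt_compat; nra.
split; first by apply: Rdiv_lt_0_compat => //; apply: pow_lt.
move=> H oriH not2 eps eps0 epslt.
have epsb : eps * C1 * b < 1.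
  have h1 : 0 < b * C1 by nra.
  have := Rmult_lt_compat_r _ _ _ h1 epslt; rewrite Rinv_l; lra.
have eC : 0 < eps * C1 by nra.
have b_lt : b < / (eps * C1).
  apply: (Rmult_lt_reg_l (eps * C1)) => //; rewrite Rinv_r; lra.
(* The lower bracket gives farness, as the Behrend loss [b ^ k] is at most [1 / (eps * C1)]; the
   upper one makes [k] at least proportional to [ln (1 / eps)]. *)
have [k [k0 [kle klt]]] := power_bracket b1 b_lt.
pose M := ((S * 2 ^ k) ^ k)%N; pose N := (M * S.+1)%N; pose D := (h.+1 * N * S.+1)%N.
have M0 : (0 < M)%N by rewrite expn_gt0 muln_gt0 S0 expn_gt0.
have N0 : (0 < N)%N by rewrite muln_gt0 M0.
have D0 : (0 < D)%N by rewrite /D !(muln_gt0, N0).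
have [m [mM mP]] := sparse_far_tournaments oriH not2 k0.
rewrite -/S -/M -/N in mM mP.
(* [rho] is the largest value for which the model copies fit, and it is positive once [D <= n]. *)
exists D => n Dn; pose rho := (n %/ D)%N.
have [|T [tourT [farT fewT]]] := mP n rho.
  have fitE (a r c d : nat) : (a * r * c * d = r * (d * c * a))%N.
    by rewrite -!mulnA mulnCA; congr (_ * _)%N; rewrite mulnC -mulnA mulnCA.
  rewrite fitE.
  exact: leq_trunc_div.
exists T; split=> //; split.
- move=> T' tourT' freeT'; have := farT T' tourT' freeT'.
  have cnt := reversal_arith M0 mM (leq_double_floor D0 Dn).
  move: cnt => /INR_leq cnt /INR_leq far; apply: Rle_trans far.
  move: cnt; rewrite -/C [INR (n ^ 2)]INR_expn mult_INR [INR (_ * C)]mult_INR.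
  rewrite [INR ((8 * S) ^ k)]INR_expn -/b -/C1.
  set Z := INR (M * m * rho ^ 2) => cnt.
  have Z0 : 0 <= Z by apply: pos_INR.
  have bk : b ^ k * (eps * C1) <= 1.
    have := Rmult_le_compat_r _ _ _ (Rlt_le _ _ eC) kle; rewrite Rinv_l; lra.
  have h1 := Rmult_le_compat_l _ _ _ (Rlt_le _ _ eps0) cnt.
  have h2 := Rmult_le_compat_l _ _ _ Z0 bk.
  apply: Rle_trans h1 _; lra.
(* The number of blocks is at most [2 * n / (h.+1 * N)], and [N] is at least
   [2 * h.+1 ^ 3 * 2 ^ (k * k)] because [S] absorbs the constant. *)
have cnt : (#|copies H T| * 2 ^ (k * k) <= n ^ h.+1)%N.
  have hN : (h.+1 * (n %/ (h.+1 * N)).+1 * N <= 2 * n)%N.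
    have hNn : (h.+1 * N <= n)%N by apply: leq_trans Dn; rewrite leq_pmulr.
    rewrite mulnAC mulnS mul2n -addnn leq_add // mulnC; exact: leq_trunc_div.
  have MS : (2 * h.+1 ^ 3 * 2 ^ (k * k) <= N)%N.
    apply: leq_trans (leq_pmulr _ _) => //; rewrite /M expnMn -expnM leq_mul2r.
    apply/orP; right; apply: leq_trans (_ : S ^ 1 <= _)%N; first by rewrite expn1 /S leq_mul2r orbT.
    by rewrite leq_pexp2l.
  rewrite -(leq_pmul2l (_ : 0 < 2 * h.+1 ^ 3)%N) ?muln_gt0 ?expn_gt0 //.
  rewrite mulnCA; apply: leq_trans (leq_mul (leqnn _) MS) _.
  apply: leq_trans (leq_mul fewT (leqnn N)) _.
  have eL (a b' y c : nat) : (a * (b' * y) * c = a * b' * (y * c))%N by rewrite !mulnA.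
  have eR (a b' c : nat) : (2 * a * (b' * c) = a * b' * (2 * c))%N.
    by rewrite -!mulnA mulnCA; congr (_ * _)%N; rewrite mulnCA.
  by rewrite eL [(n ^ h.+1)%N]expnSr eR leq_mul2l hN orbT.
move/INR_leq: cnt; rewrite mult_INR !INR_expn (_ : INR 2 = 2) // => cnt.
have e1 : eps < 1 by nra.
pose L := ln (1 / eps).
have LE : L = - ln eps by rewrite /L /Rdiv Rmult_1_l ln_Rinv.
have L0 : 0 < L by rewrite LE; have := ln_increasing _ _ eps0 e1; rewrite ln_1; lra.
have bk0 : 0 < b ^ k.+1 by apply: pow_lt; lra.
have LC : L <= INR k * C3.
  have := ln_increasing _ _ (Rinv_0_lt_compat _ eC) klt.
  rewrite ln_Rinv // ln_mult // ?ln_pow; try lra.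
  have : 1 <= INR k by apply: (@INR_leq 1).
  rewrite S_INR LE /C3 => h1 h2; nra.
have key : ln 2 / C3 ^ 2 * L * L <= INR (k * k) * ln 2.
  have sq : L * L <= INR k * INR k * C3 ^ 2 by nra.
  apply: Rle_trans (_ : ln 2 / C3 ^ 2 * (INR k * INR k * C3 ^ 2) <= _).
    rewrite Rmult_assoc; apply: Rmult_le_compat_l => //.
    by left; apply: Rdiv_lt_0_compat => //; apply: pow_lt.
  rewrite mult_INR; right; field; lra.
rewrite -/L /Rpower; have -> : ln 2 / C3 ^ 2 * L * ln eps = - (ln 2 / C3 ^ 2 * L * L).
  by rewrite LE; ring.
have two : 2 ^ (k * k) = exp (INR (k * k) * ln 2).
  by rewrite -ln_pow ?exp_ln; try lra; apply: pow_lt; lra.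
have : exp (- (INR (k * k) * ln 2)) <= exp (- (ln 2 / C3 ^ 2 * L * L)).
  have [lt|->] : - (INR (k * k) * ln 2) <= - (ln 2 / C3 ^ 2 * L * L) by lra.
    by left; apply: exp_increasing.
  by right.
have n0 : 0 <= INR n ^ h.+1 by apply: pow_le; apply: pos_INR.
move=> le; apply: Rle_trans (Rmult_le_compat_r _ _ _ n0 le).
rewrite exp_Ropp -two; have t0 : 0 < 2 ^ (k * k) by apply: pow_lt; lra.
apply: (Rmult_le_reg_r (2 ^ (k * k))) => //.
apply: Rle_trans cnt _; right; field; lra.
Qed.
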